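(* Let $\mathcal X$ be the fundamental pattern of a matroid $M$. Then $\operatorname{mr}\mathcal R(\mathcal X)=\operatorname{tri}(\mathcal X)=r(M)$, and $M$ is the unique matroid of this rank in $\mathcal R(\mathcal X)$.
   Context: The fundamental pattern of a matroid $M$ is the $\{0,*\}$-matrix with one row for each hyperplane of $M$ and one column for each element of $E(M)$ (columns labeled by the elements), whose entry in row $H$, column $e$ is $0$ if and only if $e\in H$. For a pattern $\mathcal Y$, the zero set of a row is the set of column labels where it has entry $0$; $\mathcal R(\mathcal Y)$ is the set of matroids on the set of column labels of $\mathcal Y$ in which the zero set of every row is a flat; $\operatorname{mr}\mathcal R(\mathcal Y)$ is the smallest rank of a matroid in it. A square pattern is a triangle if its rows and columns can be permuted independently to give a lower triangular pattern with all diagonal entries $*$; $\operatorname{tri}(\mathcal Y)$ is the largest $k$ such that some $k\times k$ submatrix of $\mathcal Y$ is a triangle. *)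

(* Defs.v *)
From HB Require Import structures.
From mathcomp Require Import all_boot all_fingroup.
Set Implicit Arguments.
Unset Strict Implicit.
Unset Printing Implicit Defensive.

Section Matroid.
Variable E : finType.

Definition matroid_axioms (I : {set {set E}}) : bool :=
  [&& set0 \in I,
      [forall A : {set E}, forall B : {set E},
         (B \in I) && (A \subset B) ==> (A \in I)]
    & [forall A : {set E}, forall B : {set E},
         [&& A \in I, B \in I & #|A| < #|B|] ==>
           [exists x in B :\: A, x |: A \in I]]].

(* The ground set is the whole finite type [E]. As the axioms are boolean,
   Leibniz equality of matroids is equality of their independent sets. *)
Record matroid := Matroid {
  indep : {set {set E}};
  _ : matroid_axioms indep
}.

HB.instance Definition _ := [isSub for indep].
HB.instance Definition _ := [Finite of matroid by <:].

Implicit Type M : matroid.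

Definition rk M (A : {set E}) : nat :=
  \max_(I in indep M | I \subset A) #|I|.

Definition rank M : nat := rk M [set: E].

Definition cl M (A : {set E}) : {set E} :=
  [set e | rk M (e |: A) == rk M A].

Definition is_flat M (F : {set E}) : bool := cl M F == F.

(* [(rk M H).+1 == rank M] rather than [rk M H == (rank M).-1]: truncated
   predecessor would turn the flat of a rank 0 matroid into a hyperplane. *)
Definition is_hyperplane M (H : {set E}) : bool :=
  is_flat M H && ((rk M H).+1 == rank M).

Lemma free_matroid_subproof : matroid_axioms [set: {set E}].
Proof.
apply/and3P; split; first by rewrite inE.
  by apply/forallP=> A; apply/forallP=> B; rewrite !inE implybT.
apply/forallP=> A; apply/forallP=> B; apply/implyP=> /and3P[_ _ ltAB].
have /subsetPn[x Bx Ax] : ~~ (B \subset A).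
  by apply: contraL ltAB => sBA; rewrite -leqNgt subset_leq_card.
by apply/existsP; exists x; rewrite !inE Ax Bx.
Qed.

Definition free_matroid : matroid := Matroid free_matroid_subproof.

Lemma rk_free_matroid (A : {set E}) : rk free_matroid A = #|A|.
Proof.
apply/eqP; rewrite eqn_leq; apply/andP; split.
  by apply/bigmax_leqP=> I /andP[_ sIA]; exact: subset_leq_card.
by apply: (@leq_bigmax_cond _ _ (fun I : {set E} => #|I|)); rewrite inE subxx.
Qed.

Lemma free_matroid_flat (A : {set E}) : is_flat free_matroid A.
Proof.
apply/eqP/setP=> e; rewrite inE !rk_free_matroid cardsU1.
by case: (e \in A); rewrite ?eqxx // -[X in _ == X]add0n eqn_add2r.
Qed.

End Matroid.

(* A {0,*}-matrix with labelled rows and columns: [true] stands for the entry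
   * and [false] for the entry 0. *)
Definition pattern (R C : finType) := R -> C -> bool.

Section Pattern.
Variables (R C : finType).
Implicit Type Y : pattern R C.

Definition zero_set Y (i : R) : {set C} := [set j | ~~ Y i j].

Definition pattern_matroids Y : {set matroid C} :=
  [set N | [forall i, is_flat N (zero_set Y i)]].

Lemma pattern_matroids_rank_exists Y :
  exists n, [exists N in pattern_matroids Y, rank N == n].
Proof.
exists (rank (free_matroid C)); apply/existsP; exists (free_matroid C).
by rewrite eqxx andbT inE; apply/forallP=> i; exact: free_matroid_flat.
Qed.

Definition mr Y : nat := ex_minn (pattern_matroids_rank_exists Y).

Definition lower_triangular k (T : pattern 'I_k 'I_k) : bool :=
  [forall i : 'I_k, forall j : 'I_k, (i < j) ==> ~~ T i j].

Definition is_triangle k (T : pattern 'I_k 'I_k) : bool :=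
  [exists s : 'S_k, exists t : 'S_k,
     lower_triangular (fun i j => T (s i) (t j))
     && [forall i, T (s i) (t i)]].

(* Injections [r] and [c] choose the k rows and k columns of a submatrix; their
   order is immaterial since [is_triangle] allows arbitrary permutations. *)
Definition has_triangle Y k : bool :=
  [exists r : {ffun 'I_k -> R}, exists c : {ffun 'I_k -> C},
     [&& injectiveb r, injectiveb c & is_triangle (fun i j => Y (r i) (c j))]].

Lemma has_triangle_exists Y : exists k, has_triangle Y k.
Proof.
exists 0; apply/existsP; exists (ffun0 (card_ord 0)).
apply/existsP; exists (ffun0 (card_ord 0)).
apply/and3P; split; [by apply/injectiveP; case | by apply/injectiveP; case |].
apply/existsP; exists 1%g; apply/existsP; exists 1%g.
by apply/andP; split; apply/forallP; case.
Qed.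

Lemma has_triangle_leq Y k : has_triangle Y k -> k <= #|R|.
Proof.
case/existsP=> r /existsP[c /and3P[/injectiveP r_inj _ _]].
by rewrite -[k]card_ord; exact: leq_card r_inj.
Qed.

Definition tri Y : nat :=
  ex_maxn (has_triangle_exists Y) (@has_triangle_leq Y).

End Pattern.

Definition fundamental_pattern (E : finType) (M : matroid E) :
    pattern {H : {set E} | is_hyperplane M H} E :=
  fun H e => e \notin val H.

Arguments fundamental_pattern {E} M H e.

(* Main.v *)
Require Import Defs.
From mathcomp Require Import all_boot all_fingroup.

(** A set [A] is independent as soon as every nonempty subset [B] of [A] has an
    element [a] that some flat containing [B :\ a] misses.  The columns of a
    triangle have this property in every matroid of [pattern_matroids], so [tri]
    is at most [mr].  For a basis [B] of [M] the hyperplanes [cl M (B :\ b)],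
    [b] in [B], give a diagonal submatrix, so [tri] is at least [rank M] and
    every basis of [M] is independent in every such matroid [N].  Conversely, if
    [rank N = rank M], a basis of [N] that is not a basis of [M] lies in some
    hyperplane of [M]; this is a flat of [N] containing a basis of [N], hence
    everything, which is absurd. *)

Set Implicit Arguments.
Unset Strict Implicit.
Unset Printing Implicit Defensive.

(** * Rank, closure and hyperplanes from the independence axioms *)

Section MatroidTheory.
Variables (E : finType) (M : matroid E).
Implicit Types (A B F I J : {set E}) (e x : E).

Lemma indep0 : set0 \in indep M.
Proof. by case: M => J /= /and3P[]. Qed.

Lemma indepS A B : A \subset B -> B \in indep M -> A \in indep M.
Proof.
case: M => J /= /and3P[_ /forallP/(_ A)/forallP/(_ B)/implyP hJ _] sAB BJ.
by apply: hJ; rewrite BJ.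
Qed.

Lemma indep_augment A B : A \in indep M -> B \in indep M -> #|A| < #|B| ->
  exists2 x, x \in B :\: A & x |: A \in indep M.
Proof.
case: M => J /= /and3P[_ _ /forallP/(_ A)/forallP/(_ B)/implyP hJ] AJ BJ ltAB.
have /existsP[x /andP[xBA xA]] : [exists x in B :\: A, x |: A \in J].
  by apply: hJ; rewrite AJ BJ.
by exists x.
Qed.

Lemma card_indep_rk A I : I \in indep M -> I \subset A -> #|I| <= rk M A.
Proof.
by move=> iI sIA; apply: (@leq_bigmax_cond _ _ (fun I => #|I|)); rewrite iI.
Qed.

Lemma card_indep_rank I : I \in indep M -> #|I| <= rank M.
Proof. by move=> iI; apply: card_indep_rk => //; exact: subsetT. Qed.

Lemma rk_basis A : exists I, [/\ I \in indep M, I \subset A & #|I| = rk M A].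
Proof.
have P0 : (set0 \in indep M) && (set0 \subset A) by rewrite indep0 sub0set.
rewrite /rk (@bigmax_eq_arg _ set0 _ (fun I => #|I|) P0).
by case: arg_maxnP => // I /andP[iI sIA] _; exists I.
Qed.

(** A largest independent set between [I] and [A] could otherwise be augmented from a basis of
    [A]. *)
Lemma indep_extend A I : I \in indep M -> I \subset A ->
  exists J, [/\ J \in indep M, I \subset J, J \subset A & #|J| = rk M A].
Proof.
move=> iI sIA.
have PI : [&& I \in indep M, I \subset I & I \subset A] by rewrite iI subxx.
case: (@arg_maxnP _ I [pred J | [&& J \in indep M, I \subset J & J \subset A]]
        (fun J => #|J|) PI) => J /and3P[iJ sIJ sJA] maxJ.
exists J; split=> //; apply/eqP; rewrite eqn_leq card_indep_rk //= leqNgt.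
have [K [iK sKA <-]] := rk_basis A.
apply/negP=> /(indep_augment iJ iK)[x /setDP[xK xJ] ixJ].
have := maxJ (x |: J); rewrite /= ixJ (subset_trans sIJ (subsetUr _ _)) subUset.
rewrite sub1set (subsetP sKA) // sJA => /(_ isT).
by rewrite /= cardsU1 xJ ltnn.
Qed.

Lemma rk_indep I : I \in indep M -> rk M I = #|I|.
Proof.
move=> iI; have [J [_ sIJ sJI <-]] := indep_extend iI (subxx I).
by have /eqP-> : J == I by rewrite eqEsubset sJI.
Qed.

Lemma rkS A B : A \subset B -> rk M A <= rk M B.
Proof.
move=> sAB; have [I [iI sIA <-]] := rk_basis A.
by apply: card_indep_rk => //; exact: subset_trans sAB.
Qed.

Lemma sub_cl A : A \subset cl M A.
Proof. by apply/subsetP=> e eA; rewrite inE (setUidPr _) ?sub1set. Qed.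

(** If the rank grew, a basis of [A] could be augmented by some [x] in [cl M A], and [x |: A] would
    have larger rank than [A]. *)
Lemma rk_cl A : rk M (cl M A) = rk M A.
Proof.
apply/eqP; rewrite eqn_leq (rkS (sub_cl A)) andbT leqNgt.
have [I [iI sIA cI]] := rk_basis A; have [J [iJ sJA cJ]] := rk_basis (cl M A).
rewrite -cI -cJ; apply/negP=> /(indep_augment iI iJ)[x /setDP[xJ xI] ixI].
have := subsetP sJA _ xJ; rewrite inE => /eqP rx.
have := card_indep_rk ixI (setUS [set x] sIA).
by rewrite cardsU1 xI rx -cI ltnn.
Qed.

Lemma clS A B : A \subset B -> cl M A \subset cl M B.
Proof.
move=> sAB; apply/subsetP=> e; rewrite !inE => /eqP reA.
rewrite eqn_leq (rkS (subsetUr _ _)) andbT leqNgt; apply/negP.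
have [I [iI sIA cI]] := rk_basis A.
have [J [iJ sIJ sJB cJ]] := indep_extend iI (subset_trans sIA sAB).
have [K [iK sKB cK]] := rk_basis (e |: B).
rewrite -cJ -cK => /(indep_augment iJ iK)[x /setDP[xK xJ] ixJ].
(* Since [J] is already a basis of [B], the augmenting element can only be [e]; then [e |: I] is
   independent in [e |: A], too large for the rank of [A]. *)
have /setU1P[xe | xB] := subsetP sKB _ xK; last first.
  have /(card_indep_rk ixJ) : x |: J \subset B by rewrite subUset sub1set xB.
  by rewrite cardsU1 xJ cJ ltnn.
have eI : e \notin I by apply: contra xJ => eI; rewrite xe (subsetP sIJ).
have := card_indep_rk (indepS (setUS [set x] sIJ) ixJ).
rewrite xe => /(_ _ (setUS [set e] sIA)).
by rewrite cardsU1 eI reA -cI ltnn.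
Qed.

Lemma cl_flat A : is_flat M (cl M A).
Proof.
rewrite /is_flat eqEsubset sub_cl andbT; apply/subsetP=> e.
rewrite !inE rk_cl => /eqP re; rewrite eqn_leq (rkS (subsetUr _ _)) andbT -re.
by rewrite rkS // setUS ?sub_cl.
Qed.

Lemma cl_sub_flat A F : is_flat M F -> A \subset F -> cl M A \subset F.
Proof. by move=> /eqP fF /clS; rewrite fF. Qed.

Lemma mem_cl_indep I e :
  I \in indep M -> e \notin I -> (e \in cl M I) = (e |: I \notin indep M).
Proof.
move=> iI eI; rewrite inE (rk_indep iI); apply/idP/idP => [/eqP re | ne].
  by apply/negP=> /rk_indep; rewrite re cardsU1 eI => /eqP; rewrite ltn_eqF.
(* If [e |: I] is dependent, its basis [J] is a proper subset, so it has at most [#|I|] elements. *)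
have [J [iJ sIJ sJe cJ]] := indep_extend iI (subsetUr [set e] I).
rewrite eqn_leq -{2}(rk_indep iI) (rkS (subsetUr _ _)) andbT -cJ -ltnS.
have -> : #|I|.+1 = #|e |: I| by rewrite cardsU1 eI.
apply: proper_card; rewrite properEneq sJe andbT.
by apply: contraNneq ne => <-.
Qed.

Lemma rank_cl_indep I : I \in indep M -> #|I| = rank M -> cl M I = [set: E].
Proof.
move=> iI cI; apply/setP=> e; rewrite !inE eqn_leq (rkS (subsetUr _ _)) andbT.
by rewrite (rk_indep iI) cI rkS ?subsetT.
Qed.

(** By induction [A :\ a] is independent; were [A] dependent, [a] would lie in the closure of
    [A :\ a], hence in [F]. *)
Lemma indep_of_flats A :
  (forall B, B \subset A -> B != set0 ->
     exists a F, [/\ a \in B, is_flat M F, B :\ a \subset F & a \notin F]) ->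
  A \in indep M.
Proof.
have [n leAn] := ubnP #|A|; elim: n A leAn => // n IHn A leAn hA.
have [->|A0] := eqVneq A set0; first exact: indep0.
have [a [F [aA fF sF aF]]] := hA _ (subxx A) A0.
have iAa : A :\ a \in indep M.
  apply: IHn => [|B sB B0].
    by move: leAn; rewrite (cardsD1 a A) aA.
  by apply: hA B0; exact: subset_trans sB (subsetDl _ _).
apply: contraNT aF => nA; apply: (subsetP (cl_sub_flat fF sF)).
by rewrite mem_cl_indep ?setD1K // setD11.
Qed.

Lemma basis_hyperplane I x :
  I \in indep M -> #|I| = rank M -> x \in I -> is_hyperplane M (cl M (I :\ x)).
Proof.
move=> iI cI xI; have iIx := indepS (subsetDl I [set x]) iI.
by rewrite /is_hyperplane cl_flat rk_cl (rk_indep iIx) -cI (cardsD1 x I) xI /=.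
Qed.

Lemma indep_notin_cl I x : I \in indep M -> x \in I -> x \notin cl M (I :\ x).
Proof.
move=> iI xI; rewrite mem_cl_indep ?setD11 ?setD1K ?iI //.
exact: indepS (subsetDl _ _) iI.
Qed.

(** Extend a basis of [A] to a basis [J] of [M] and drop from [J] a new element [x]: the closure of
    the rest is the hyperplane. *)
Lemma sub_hyperplane A :
  rk M A < rank M -> exists2 H, is_hyperplane M H & A \subset H.
Proof.
have [I [iI sIA cI]] := rk_basis A; rewrite -cI => ltI.
have [J [iJ sIJ _ cJ]] := indep_extend iI (subsetT I).
have /subsetPn[x xJ xI] : ~~ (J \subset I).
  by apply: contraL ltI => /subset_leq_card; rewrite cJ -leqNgt.
exists (cl M (J :\ x)); first exact: basis_hyperplane.
have sAI : A \subset cl M I.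
  apply/subsetP=> e eA; rewrite inE eqn_leq (rkS (subsetUr _ _)) andbT.
  by rewrite (rk_indep iI) cI rkS // subUset sub1set eA.
by apply: subset_trans sAI (clS _); rewrite subsetD1 sIJ.
Qed.

End MatroidTheory.

(** * Triangles bound the rank from below *)

Lemma triangle_leq_rank (R C : finType) (Y : pattern R C) k (N : matroid C) :
  N \in pattern_matroids Y -> has_triangle Y k -> k <= rank N.
Proof.
rewrite inE => /forallP fY /existsP[r /existsP[c /and3P[_ /injectiveP c_inj]]].
case/existsP=> s /existsP[t /andP[/forallP low /forallP diag]].
pose f (i : 'I_k) := c (t i).
have f_inj : injective f by move=> i j /c_inj/perm_inj.
rewrite -[k]card_ord -cardsT -(card_imset _ f_inj); apply: card_indep_rank.
apply: indep_of_flats => B sB /set0Pn[b bB].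
have /imsetP[i0 _ bi0] := subsetP sB _ bB; have Bi0 : f i0 \in B by rewrite -bi0.
(* In the row of the least index [i] with [f i] in [B], all later columns are 0 and the diagonal
   entry is *; its zero set is the flat required. *)
case: (@arg_minnP _ i0 [pred i | f i \in B] (fun i => i) Bi0) => i /= Bi min_i.
exists (f i), (zero_set Y (r (s i))); split=> //; last by rewrite inE negbK.
apply/subsetP=> e /setD1P[ne eB]; have /imsetP[j _ ej] := subsetP sB _ eB.
rewrite ej inE; have /forallP/(_ j)/implyP := low i; apply.
rewrite ltn_neqAle min_i -?ej // andbT.
by apply: contra ne => /eqP/val_inj->; rewrite ej.
Qed.

(** * Matroids in which the hyperplanes of [M] are flats *)

Section FundamentalPattern.
Variables (E : finType) (M : matroid E).
Let X := fundamental_pattern M.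

Lemma zero_set_fundamental H : zero_set X H = val H.
Proof. by apply/setP=> e; rewrite inE negbK. Qed.

Lemma mem_pattern_fundamental (N : matroid E) :
  reflect (forall H, is_hyperplane M H -> is_flat N H)
          (N \in pattern_matroids X).
Proof.
rewrite inE; apply: (iffP forallP) => [fN H hH | fN H].
  by have := fN (Sub H hH); rewrite zero_set_fundamental SubK.
by rewrite zero_set_fundamental; apply: fN; exact: valP.
Qed.

Lemma fundamental_triangle : has_triangle X (rank M).
Proof.
have [B [iB _ cB]] := rk_basis M [set: E]; rewrite -/(rank M) in cB.
rewrite -cB.
pose c (i : 'I_#|B|) : E := enum_val i.
have c_inj : injective c by exact: enum_val_inj.
have hyp i : is_hyperplane M (cl M (B :\ c i)).
  by apply: basis_hyperplane => //; exact: enum_valP.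
pose r (i : 'I_#|B|) : {H | is_hyperplane M H} := Sub (cl M (B :\ c i)) (hyp i).
have Xrc i j : X (r i) (c j) = (i == j).
  rewrite /X /fundamental_pattern SubK; have [<-|nij] := eqVneq i j.
    by apply: indep_notin_cl => //; exact: enum_valP.
  apply/negbF/(subsetP (sub_cl _ _)); rewrite !inE enum_valP andbT.
  by rewrite (inj_eq c_inj) eq_sym.
(* Row [j] has a * in column [j], where row [i] has one only if [i = j]. *)
have r_inj : injective r.
  by move=> i j rij; apply/eqP; rewrite -Xrc rij Xrc eqxx.
apply/existsP; exists (finfun r); apply/existsP; exists (finfun c).
apply/and3P; split; try by apply/injectiveP=> i j; rewrite !ffunE; auto.
apply/existsP; exists 1%g; apply/existsP; exists 1%g; apply/andP; split.
  apply/forallP=> i; apply/forallP=> j; apply/implyP=> ltij.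
  by rewrite !ffunE !perm1 Xrc -val_eqE /= ltn_eqF.
by apply/forallP=> i; rewrite !ffunE !perm1 Xrc.
Qed.

Lemma fundamental_indepS (N : matroid E) :
  N \in pattern_matroids X -> indep M \subset indep N.
Proof.
move=> /mem_pattern_fundamental fN; apply/subsetP=> I iI.
have [J [iJ sIJ _ cJ]] := indep_extend iI (subsetT I).
apply: indepS sIJ _; apply: indep_of_flats => B sBJ /set0Pn[b bB].
have bJ := subsetP sBJ _ bB.
(* One hyperplane of [M] serves every [B] containing [b], as it contains all of [J :\ b]. *)
exists b, (cl M (J :\ b)); split=> //; last exact: indep_notin_cl.
  by apply: fN; exact: basis_hyperplane.
by apply: subset_trans (sub_cl _ _); exact: setSD.
Qed.

Lemma fundamental_unique (N : matroid E) :
  N \in pattern_matroids X -> rank N = rank M -> N = M.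
Proof.
move=> XN rN; apply: val_inj; apply/eqP; rewrite eqEsubset.
rewrite fundamental_indepS // andbT; apply/subsetP=> I iI.
have [J [iJ sIJ _ cJ]] := indep_extend iI (subsetT I).
rewrite -/(rank N) rN in cJ.
apply: indepS sIJ _; have [K [iK sKJ cK]] := rk_basis M J.
(* If [J] has full rank in [M], its [M]-basis [K] is all of [J]; otherwise [J] lies in a
   hyperplane. *)
have [ltJ | leJ] := ltnP (rk M J) (rank M); last first.
  suff /eqP<- : K == J by [].
  by rewrite eqEcard sKJ cK cJ.
have [H hH sJH] := sub_hyperplane ltJ.
have /cl_sub_flat/(_ sJH) := mem_pattern_fundamental _ XN _ hH.
rewrite (rank_cl_indep iJ) ?rN // subTset => /eqP HT.
by move: hH; rewrite HT => /andP[_]; rewrite gtn_eqF.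
Qed.

End FundamentalPattern.

Theorem theorem5p2 (E : finType) (M : matroid E) :
  let X := fundamental_pattern M in
  [/\ mr X = tri X, tri X = rank M,
      M \in pattern_matroids X
    & forall N : matroid E,
        N \in pattern_matroids X -> rank N = rank M -> N = M].
Proof.
(* Membership of [M] itself bounds both [tri X] and [mr X] by [rank M]. *)
move=> X; have XM : M \in pattern_matroids X.
  by apply/mem_pattern_fundamental=> H /andP[].
have triX : tri X = rank M.
  rewrite /tri; case: ex_maxnP => k Tk maxk; apply/eqP.
  by rewrite eqn_leq (triangle_leq_rank XM Tk) maxk ?fundamental_triangle.
split=> //; last exact: fundamental_unique.
rewrite triX /mr; case: ex_minnP => n /existsP[N /andP[XN /eqP<-]] minN.
apply/eqP; rewrite eqn_leq (triangle_leq_rank XN (fundamental_triangle M)) andbT.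
by apply: minN; apply/existsP; exists M; rewrite XM eqxx.
Qed.
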